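(* Let $F$ be a finite field with $|F|=q$, $n\ge 1$, let $\mathcal{C}\subseteq M_n(F)$ be a similarity class with minimal polynomial $\mu$, and let $a\in F$ with $x-a\mid\mu$. Put $f_a=\mu/(x-a)$ and let $r=\dim\operatorname{Im}f_a(A)$ for $A\in\mathcal{C}$ (this does not depend on $A$). Define an equivalence relation on $\mathcal{C}$ by $A\sim B$ iff $\operatorname{Im}f_a(A)=\operatorname{Im}f_a(B)$. Then this relation has exactly $$\prod_{i=1}^r\frac{q^n-q^{i-1}}{q^r-q^{i-1}}$$ equivalence classes, each of size $$|\mathcal{C}|\prod_{i=1}^r\frac{q^r-q^{i-1}}{q^n-q^{i-1}}.$$
   Context: A similarity class is an orbit of $M_n(F)$ under conjugation by $\mathrm{GL}(n,F)$; its minimal polynomial $\mu\in F[x]$ is the common minimal polynomial of its elements. For $B\in M_n(F)$, $\operatorname{Im}B$ is the image of the map $F^n\to F^n$, $v\mapsto Bv$. *)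

(* Defs.v *)
From HB Require Import structures.
From mathcomp Require Import all_boot all_order all_algebra.

Set Implicit Arguments.
Unset Strict Implicit.
Unset Printing Implicit Defensive.

Import Order.TTheory GRing.Theory Num.Theory.
Local Open Scope ring_scope.

Definition simclass (F : finFieldType) (n : nat) (A : 'M[F]_n) : {set 'M[F]_n} :=
  [set g *m A *m invmx g | g in unitmx].

Definition is_simclass (F : finFieldType) (n : nat) (C : {set 'M[F]_n}) : Prop :=
  exists A : 'M[F]_n, C = simclass A.

(* MathComp's row space of a matrix is the image of row vectors under right
   multiplication; here matrices act on column vectors, from the left. *)
Definition mximage (F : fieldType) (n : nat) (B : 'M[F]_n) : {vspace 'cV[F]_n} :=
  limg (linfun (mulmx B : 'cV[F]_n -> 'cV[F]_n)).

Definition same_image (F : fieldType) (n : nat) (f : {poly F}) :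
    rel 'M[F]_n.+1 :=
  fun A B => mximage (horner_mx A f) == mximage (horner_mx B f).

Definition class_minpoly (F : finFieldType) (n : nat) (C : {set 'M[F]_n.+1})
    (mu : {poly F}) : Prop :=
  {in C, forall A, mxminpoly A = mu}.

Lemma mem_mximage (F : fieldType) (n : nat) (B : 'M[F]_n) (w : 'cV[F]_n) :
  reflect (exists v : 'cV[F]_n, w = B *m v) (w \in mximage B).
Proof.
apply: (iffP memv_imgP) => [[v _ ->]|[v ->]].
  by exists v; rewrite lfunE.
by exists v; rewrite ?memvf ?lfunE.
Qed.

Lemma same_image_equivalence (F : fieldType) (n : nat) (f : {poly F}) :
  equivalence_rel (@same_image F n f).
Proof. by move=> A B D; rewrite /same_image eqxx; split=> // /eqP ->. Qed.

Lemma simclass_minpoly (F : finFieldType) (n : nat) (A : 'M[F]_n.+1) :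
  class_minpoly (simclass A) (mxminpoly A).
Proof.
by move=> _ /imsetP[g gU ->]; rewrite -conjumx // mxminpoly_uconj.
Qed.

(* Main.v *)
(* Conjugating [A] by [g] moves [Im f(A)] to [g Im f(A)], and [GL_n] is
   transitive on subspaces of a given dimension. Hence the images occurring in
   the class are exactly the [r]-dimensional subspaces, and all the fibres have
   the same size. Subspaces are counted through their ordered bases. *)
Require Import Defs.
From HB Require Import structures.
From mathcomp Require Import all_boot all_order all_algebra.
From mathcomp Require Import finfield mxabelem.

Import Order.TTheory GRing.Theory Num.Theory.
Local Open Scope ring_scope.

Lemma row_free_col_mx1 (F : fieldType) (n k : nat)
    (u : 'rV[F]_n) (A : 'M[F]_(k, n)) :
  row_free (col_mx u A) = row_free A && ~~ (u <= A)%MS.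
Proof.
rewrite /row_free -addsmxE.
have [uA | nuA] := boolP (u <= A)%MS.
  rewrite andbF; move/addsmx_idPr: uA => ->; apply/negbTE.
  by rewrite neq_ltn add1n ltnS rank_leq_row.
have u0 : u != 0 by apply: contraNneq nuA => ->; rewrite sub0mx.
have uA0 : (u :&: A)%MS = 0.
  apply/eqP; apply: contraNT nuA => nz; apply: submx_trans (capmxSr u A).
  (* A nonzero intersection has rank at least 1, the rank of [u], so it contains [u]. *)
  rewrite -(geq_leqif (mxrank_leqif_sup (capmxSl u A))).
  by rewrite rank_rV u0 lt0n mxrank_eq0 nz.
by rewrite mxrank_disjoint_sum // rank_rV u0 eqn_add2l andbT.
Qed.

(** Induction on [k]: a new row, placed on top, may be any vector of [V] outside the span of the [k]
    rows already chosen, and that span has [#|F| ^ k] elements. If [k] exceeds the rank of [V], both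
    sides are 0. *)
Lemma card_row_free_sub (F : finFieldType) (n m k : nat) (V : 'M[F]_(m, n)) :
  #|[set A : 'M[F]_(k, n) | row_free A && (A <= V)%MS]| =
    (\prod_(i < k) (#|F| ^ \rank V - #|F| ^ i))%N.
Proof.
elim: k => [|k IHk].
  rewrite big_ord0; apply/eqP/cards1P; exists 0; apply/setP => A.
  by rewrite !inE [A]flatmx0 sub0mx /row_free mxrank0 !eqxx.
rewrite big_ord_recr /= -IHk -sum1dep_card.
rewrite (reindex (fun p : 'M[F]_(k, n) * 'rV[F]_n =>
                    col_mx p.2 p.1 : 'M_(1 + k, n))) /=; last first.
  exists (fun A : 'M_(1 + k, n) => (dsubmx A, usubmx A)) => [[A u] _ | A _] /=.
    by rewrite col_mxKu col_mxKd.
  by rewrite vsubmxK.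
transitivity (\sum_(A : 'M[F]_(k, n) | row_free A && (A <= V)%MS)
                \sum_(u in rowg V :\: rowg A) 1)%N.
  rewrite pair_big_dep; apply: eq_bigl => -[A u].
  rewrite row_free_col_mx1 -(addsmxE u A) addsmx_sub !inE /=.
  by rewrite [(u <= V)%MS && _]andbC andbACA.
rewrite -sum_nat_const; apply: eq_big => A; [by rewrite inE | case/andP=> /eqP rA sAV].
rewrite sum1_card cardsD (setIidPr _) ?card_rowg ?rA //.
by apply/subsetP => u; rewrite !inE => /submx_trans; apply.
Qed.

(* Each subspace is represented by its canonical generating matrix, in row
   vectors; the image of [B] corresponds to the row space of [B^T]. *)
Definition subspaces (F : finFieldType) (n r : nat) : {set 'M[F]_n} :=
  [set S | (<<S>>%MS == S) && (\rank S == r)].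

(** Free families of [r] rows are grouped by their span [S]. A free family of [r] rows inside [S]
    spans it by rank, so each group consists of the ordered bases of [S]. The multiplied form avoids
    division in [nat]. *)
Lemma card_subspaces (F : finFieldType) (n r : nat) :
  (#|subspaces F n r| * \prod_(i < r) (#|F| ^ r - #|F| ^ i) =
    \prod_(i < r) (#|F| ^ n - #|F| ^ i))%N.
Proof.
have := card_row_free_sub F n n r 1%:M; rewrite mxrank1 => <-.
rewrite -[RHS]sum1_card (partition_big (fun A => <<A>>%MS) (mem (subspaces F n r))) /=;
  last first.
  by move=> A; rewrite !inE genmx_id eqxx mxrank_gen => /andP[].
rewrite -sum_nat_const; apply: eq_bigr => S; rewrite inE => /andP[/eqP gS /eqP rS].
rewrite -[in LHS]rS -card_row_free_sub sum1dep_card rS; apply: eq_card => A.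
rewrite !inE submx1 andbT; case: (boolP (row_free A)) => //= /eqP rA.
rewrite -[in RHS]gS; apply/idP/eqP => [sAS | /genmxP/andP[] //].
apply/genmxP; rewrite sAS -(geq_leqif (mxrank_leqif_sup sAS)).
by rewrite rA rS leqnn.
Qed.

(** Transitivity of GL_n. Gaussian elimination writes both matrices as unit * [pid_mx] * unit with
    the same middle factor; the left unit does not affect the row space, so it suffices to exchange
    the right one. *)
Lemma eqmx_unitmx (F : fieldType) (m n : nat) (A B : 'M[F]_(m, n)) :
  \rank A = \rank B -> exists2 g : 'M[F]_n, g \in unitmx & (A *m g == B)%MS.
Proof.
move=> rAB; exists (invmx (row_ebase A) *m row_ebase B).
  by rewrite unitmx_mul unitmx_inv !row_ebase_unit.
apply/eqmxP; rewrite -{1}(mulmx_ebase A) -[X in (_ :=: X)%MS](mulmx_ebase B).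
rewrite -!mulmxA (mulKVmx (row_ebase_unit A)) rAB.
apply: eqmx_trans (eqmxMfull _ _) (eqmx_sym (eqmxMfull _ _));
  by rewrite row_full_unit col_ebase_unit.
Qed.

Lemma mem_mximage_tr (F : fieldType) (n : nat) (B : 'M[F]_n) (w : 'cV[F]_n) :
  (w \in mximage B) = (w^T <= B^T)%MS.
Proof.
apply/mem_mximage/submxP => [[v ->]|[v wE]].
  by exists v^T; rewrite trmx_mul.
by exists v^T; apply: trmx_inj; rewrite wE trmx_mul trmxK.
Qed.

Lemma eq_mximage (F : fieldType) (n : nat) (A B : 'M[F]_n) :
  (mximage A == mximage B) = (<<A^T>>%MS == <<B^T>>%MS).
Proof.
apply/eqP/eqP => [eqAB | /genmxP/eqmxP eqAB]; last first.
  by apply/vspaceP => w; rewrite !mem_mximage_tr eqAB.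
have sub X Y : mximage X = mximage Y -> (X^T <= Y^T)%MS.
  (* Row [i] of [X^T] is the transpose of column [i] of [X], a vector of the image. *)
  move=> eqXY; apply/row_subP => i.
  by rewrite -tr_col -mem_mximage_tr -eqXY mem_mximage_tr tr_col row_sub.
by apply/genmxP; rewrite !sub.
Qed.

(** Over a finite field the cardinality of a space determines its dimension, and transposition is a
    bijection from the image onto the row space of [B^T]. *)
Lemma dim_mximage (F : finFieldType) (n : nat) (B : 'M[F]_n) :
  \dim (mximage B) = \rank B^T.
Proof.
apply/eqP; rewrite -(eqn_exp2l _ _ (finNzRing_gt1 F)) -card_vspace -card_rowg.
rewrite -(card_imset _ (@trmx_inj _ _ _)); apply/eqP/eq_card => u.
rewrite mem_rowg; apply/imsetP/idP => [[w] | uB].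
  by rewrite mem_mximage_tr => wB ->.
by exists u^T; rewrite ?mem_mximage_tr trmxK.
Qed.

Lemma invmxM (F : fieldType) (n : nat) (A B : 'M[F]_n) :
  A \in unitmx -> B \in unitmx -> invmx (A *m B) = invmx B *m invmx A.
Proof.
move=> AU BU; have ABU : A *m B \in unitmx by rewrite unitmx_mul AU.
apply: (can_inj (mulKmx ABU)).
by rewrite mulmxV // mulmxA mulmxK // mulmxV.
Qed.

Lemma simclass_conj (F : finFieldType) (n : nat) (M A g : 'M[F]_n) :
  g \in unitmx -> A \in simclass M -> g *m A *m invmx g \in simclass M.
Proof.
move=> gU /imsetP[h hU ->]; apply/imsetP; exists (g *m h).
  by rewrite unitmx_mul gU.
by rewrite invmxM // !mulmxA.
Qed.

Lemma simclass_trans (F : finFieldType) (n : nat) (M A B : 'M[F]_n) :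
  A \in simclass M -> B \in simclass M ->
  exists2 g, g \in unitmx & B = g *m A *m invmx g.
Proof.
move=> /imsetP[h hU ->] /imsetP[k kU ->]; exists (k *m invmx h).
  by rewrite unitmx_mul kU unitmx_inv.
by rewrite invmxM ?unitmx_inv // invmxK !mulmxA !mulmxKV.
Qed.

(** Since f(gAg^-1) = g f(A) g^-1, transposing puts the inverse factor on the left, where it leaves
    the row space unchanged. *)
Lemma horner_conj_trmx (F : fieldType) (n : nat) (A g : 'M[F]_n.+1)
    (f : {poly F}) :
  g \in unitmx ->
  ((horner_mx (g *m A *m invmx g) f)^T :=: (horner_mx A f)^T *m g^T)%MS.
Proof.
move=> gU; rewrite horner_mx_uconj // !trmx_mul.
by apply: eqmxMfull; rewrite row_full_unit unitmx_tr unitmx_inv.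
Qed.

Lemma same_image_conj (F : fieldType) (n : nat) (A B g : 'M[F]_n.+1)
    (f : {poly F}) :
  g \in unitmx -> same_image f A B ->
  same_image f (g *m A *m invmx g) (g *m B *m invmx g).
Proof.
move=> gU; rewrite /same_image !eq_mximage => /eqP/genmxP/eqmxP eqAB.
apply/eqP/genmxP/eqmxP.
have conjE := horner_conj_trmx _ _ _ g f gU.
exact: eqmx_trans (conjE A) (eqmx_trans (eqmxMr _ eqAB) (eqmx_sym (conjE B))).
Qed.

(** Conjugation by a [g] that carries [A] to [B] injects the first fibre into the second. Exchanging
    [A] and [B] gives equality. *)
Lemma card_same_image_le (F : finFieldType) (n : nat) (M A B : 'M[F]_n.+1)
    (f : {poly F}) :
  A \in simclass M -> B \in simclass M ->
  (#|[set D in simclass M | same_image f A D]| <=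
   #|[set D in simclass M | same_image f B D]|)%N.
Proof.
move=> AC BC; have [g gU ->] := simclass_trans F n.+1 M A B AC BC.
rewrite -(card_imset _ (can_inj (_ : cancel (fun D => g *m D *m invmx g)
                                  (fun D => invmx g *m D *m g)))); last first.
  by move=> D; rewrite !mulmxA mulmxKV // mulVmx // mul1mx.
apply/subset_leq_card/subsetP => _ /imsetP[D /setIdP[DC AD] ->].
by rewrite inE simclass_conj ?same_image_conj.
Qed.

Lemma image_simclass (F : finFieldType) (n : nat) (M A : 'M[F]_n.+1)
    (f : {poly F}) :
  A \in simclass M ->
  [set <<(horner_mx D f)^T>>%MS | D in simclass M] =
    subspaces F n.+1 (\dim (mximage (horner_mx A f))).
Proof.
move=> AC; rewrite dim_mximage; apply/setP => S; rewrite inE.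
apply/imsetP/andP => [[D DC ->] | [/eqP gS /eqP rS]].
  have [g gU ->] := simclass_trans F n.+1 M A D AC DC.
  rewrite genmx_id eqxx mxrank_gen horner_conj_trmx // mxrankMfree //.
  by rewrite row_free_unit unitmx_tr.
have [g gU /genmxP] := eqmx_unitmx _ _ _ _ _ (esym rS).
(* Conjugation by [h] multiplies the transposed row space by [h^T], hence the choice of [g^T] as
   conjugator. *)
rewrite gS => <-; exists (g^T *m A *m invmx g^T).
  by rewrite simclass_conj ?unitmx_tr.
apply/genmxP/eqmxP; rewrite -[in X in (X :=: _)%MS](trmxK g).
by apply/eqmx_sym/horner_conj_trmx; rewrite unitmx_tr.
Qed.

Lemma card_same_image_classes (F : finFieldType) (n : nat) (M A : 'M[F]_n.+1)
    (f : {poly F}) :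
  A \in simclass M ->
  #|equivalence_partition (same_image f) (simclass M)| =
    #|subspaces F n.+1 (\dim (mximage (horner_mx A f)))|.
Proof.
move=> AC; rewrite -(image_simclass _ _ M) //.
(* [block] turns an image into its fibre. It is injective on the images that occur, because each is
   attained by some [D], which lies in its own fibre only. *)
pose block S := [set D in simclass M | <<(horner_mx D f)^T>>%MS == S].
rewrite -[RHS](@card_in_imset _ _ block) => [|_ _ /imsetP[D DC ->] /imsetP[E EC ->]].
  congr #|pred_of_set _|; rewrite -imset_comp; apply: eq_imset => D /=.
  by apply/setP => E; rewrite !inE /same_image eq_mximage eq_sym.
by move/setP/(_ D); rewrite !inE DC eqxx /= => /esym/eqP.
Qed.

Lemma card_same_image_class (F : finFieldType) (n : nat) (M : 'M[F]_n.+1)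
    (f : {poly F}) (K : {set 'M[F]_n.+1}) :
  let classes := equivalence_partition (same_image f) (simclass M) in
  K \in classes -> #|simclass M| = (#|classes| * #|K|)%N.
Proof.
move=> classes /imsetP[A AC ->]; apply: card_uniform_partition.
  move=> _ /imsetP[B BC ->].
  by apply/eqP; rewrite eqn_leq !card_same_image_le.
by apply: equivalence_partitionP => ? ? ? _ _ _; apply: same_image_equivalence.
Qed.

(** Here i < r <= m, so no subtraction in [nat] is truncated; the index is shifted to run from 1 to
    [r]. *)
Lemma natr_prod_exp_sub (q m r : nat) : (1 < q)%N -> (r <= m)%N ->
  (\prod_(i < r) (q ^ m - q ^ i))%N%:R =
    \prod_(1 <= i < r.+1) (q%:R ^+ m - q%:R ^+ (i - 1)) :> rat.
Proof.
move=> q1 rm; rewrite big_add1 big_mkord natr_prod; apply: eq_bigr => i _.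
by rewrite subn1 natrB ?natrX // leq_exp2l // ltnW // (leq_trans _ rm).
Qed.

Lemma prod_exp_sub_neq0 (q m r : nat) : (1 < q)%N -> (r <= m)%N ->
  \prod_(1 <= i < r.+1) (q%:R ^+ m - q%:R ^+ (i - 1)) != 0 :> rat.
Proof.
move=> q1 rm; rewrite -natr_prod_exp_sub // pnatr_eq0 -lt0n prodn_gt0 // => i.
by rewrite subn_gt0 ltn_exp2l // (leq_trans _ rm).
Qed.

Theorem theorem4p7 (F : finFieldType) (q : nat) (hq : #|F| = q) (n : nat)
    (C : {set 'M[F]_n.+1}) (hC : is_simclass C)
    (mu : {poly F}) (hmu : class_minpoly C mu)
    (a : F) (ha : 'X - a%:P %| mu)
    (A0 : 'M[F]_n.+1) (hA0 : A0 \in C) :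
  let f_a : {poly F} := mu %/ ('X - a%:P) in
  let r := \dim (mximage (horner_mx A0 f_a)) in
  let classes := equivalence_partition (same_image f_a) C in
  [/\ forall A : 'M[F]_n.+1, A \in C -> \dim (mximage (horner_mx A f_a)) = r,
      #|classes|%:R =
        \prod_(1 <= i < r.+1)
          ((q%:R ^+ n.+1 - q%:R ^+ (i - 1)) / (q%:R ^+ r - q%:R ^+ (i - 1)))
        :> rat
    & forall K : {set 'M[F]_n.+1}, K \in classes ->
      #|K|%:R =
        #|C|%:R *
        \prod_(1 <= i < r.+1)
          ((q%:R ^+ r - q%:R ^+ (i - 1)) / (q%:R ^+ n.+1 - q%:R ^+ (i - 1)))
        :> rat].
Proof.
move: hA0; case: hC => M -> A0C f_a r classes.
have q1 : (1 < q)%N by rewrite -hq finNzRing_gt1.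
have rn : (r <= n.+1)%N by rewrite /r dim_mximage rank_leq_row.
have nzn := prod_exp_sub_neq0 q n.+1 r q1 rn.
have nzr := prod_exp_sub_neq0 q r r q1 (leqnn r).
have cardE : #|classes|%:R = \prod_(1 <= i < r.+1)
    ((q%:R ^+ n.+1 - q%:R ^+ (i - 1)) / (q%:R ^+ r - q%:R ^+ (i - 1))) :> rat.
  (* Clearing the denominator reduces the claim to the multiplied form in [card_subspaces]. *)
  rewrite prodf_div; apply: (canRL (mulfK nzr)).
  rewrite -!natr_prod_exp_sub // -natrM; congr _%:R.
  by rewrite /classes (card_same_image_classes F n M A0) // -hq card_subspaces.
split=> // [A AC | K /card_same_image_class ->].
  (* The images in the class are described through [A0], so that of [A] has dimension [r]. *)
  have: <<(horner_mx A f_a)^T>>%MS \in subspaces F n.+1 r.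
    by rewrite -(image_simclass F n M) //; apply: imset_f.
  by rewrite inE mxrank_gen -dim_mximage => /andP[_ /eqP].
(* The size of the class is now the number of fibres times [#|K|], and the two quotients of products
   are mutually inverse. *)
by rewrite natrM cardE !prodf_div [RHS]mulrAC mulrA divfK // divff // mul1r.
Qed.
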